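(* For $p$ an odd prime, a finite $p$-group $G$ satisfying $\Omega_1(\gamma_{p-1}(G))\leq \operatorname{Z}(G)$ need not be power closed; that is, for every odd prime $p$ there exists a finite $p$-group $G$ such that $\Omega_1(\gamma_{p-1}(G))\leq \operatorname{Z}(G)$ and $G$ is not power closed.
   Context: For a finite $p$-group $S$ and a positive integer $n$, $\Omega_n(S)$ denotes the subgroup generated by the elements of $S$ of order dividing $p^n$, and $S^{p^n}$ denotes the subgroup generated by the $p^n$-th powers of all elements of $S$. $\gamma_i(G)$ denotes the $i$-th term of the lower central series of $G$, with $\gamma_1(G)=G$ and $\gamma_{i+1}(G)=[\gamma_i(G),G]$. $\operatorname{Z}(G)$ is the center of $G$. A finite $p$-group $G$ is called power closed if for every positive integer $n$, every element of $G^{p^n}$ is a $p^n$-th power of an element of $G$. *)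

(* Defs.v *)
From HB Require Import structures.
From mathcomp Require Import all_boot all_fingroup all_solvable.

Set Implicit Arguments.
Unset Strict Implicit.
Unset Printing Implicit Defensive.

Local Open Scope group_scope.

(* The library's 'Ohm_n(G) and 'Mho^n(G) do not mention p; when G is a p-group,
   lemmas OhmE and MhoE identify them with the subgroups of G generated by the
   elements of order dividing p ^ n and by the (p ^ n)-th powers. *)
Definition power_closed (p : nat) (gT : finGroupType) (G : {group gT}) : Prop :=
  forall n : nat, 0 < n ->
  forall x : gT, x \in 'Mho^n(G) -> exists2 y : gT, y \in G & x = y ^+ (p ^ n).

(* Main.v *)
Require Import Defs.
From HB Require Import structures.
From mathcomp Require Import all_boot all_fingroup all_solvable.
From mathcomp Require Import all_algebra.

Import GRing.Theory.

Local Open Scope group_scope.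

(* Let A = (Z/p^2)^(p-1) x F_p, with the shift t sending each coordinate to the
   next one (reducing modulo p at the last step), so that p^2 = 0, t^p = 0 and
   p t^(p-1) = 0 on A. Let s = 1 + t and G = A ><| <s>, realised as affine
   permutations of A.
   For p odd, L_(p-1)(G) lies in t^(p-2) A, and p t^(p-2) x = 0 forces
   t^(p-1) x = 0, so s fixes the elements of order p there: they are central.
   On the other hand (s a)^p s^-p is translation by N(a), where
   N = 1 + s + ... + s^(p-1) is congruent to t^(p-1) modulo p, so N(a) is not
   in pA for a suitable a. As s has order p^2, an element s^i b whose p-th power
   is a translation has p | i; then s^i is 1 modulo p and its p-th power
   is translation by an element of pA. *)

(** * Binomial formulas for the powers of 1 + t, with t an additive endomorphism *)

Section IterAdditive.
Set Implicit Arguments.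
Unset Strict Implicit.
Local Open Scope ring_scope.
Variables (A : zmodType) (t : {additive A -> A}).

Lemma iter_is_zmod_morphism k : zmod_morphism (iter k t).
Proof. by elim: k => [|k IHk] x y //=; rewrite IHk raddfB. Qed.

HB.instance Definition _ k :=
  GRing.isZmodMorphism.Build A A (iter k t) (iter_is_zmod_morphism k).

Definition one_plus x := x + t x.

Lemma one_plus_is_zmod_morphism : zmod_morphism one_plus.
Proof. by move=> x y; rewrite /one_plus raddfB opprD addrACA. Qed.

HB.instance Definition _ :=
  GRing.isZmodMorphism.Build A A one_plus one_plus_is_zmod_morphism.

Lemma iter_one_plus k x :
  iter k one_plus x = \sum_(j < k.+1) iter j t x *+ 'C(k, j).
Proof.
elim: k => [|k IHk]; first by rewrite big_ord1.
rewrite iterS IHk {1}/one_plus raddf_sum [RHS]big_ord_recl /=.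
under [in RHS]eq_bigr do rewrite /bump add1n binS mulrnDr.
rewrite big_split addrA /=; congr (_ + _); last first.
  by apply: eq_bigr => i _; rewrite raddfMn.
transitivity (\sum_(j < k.+2) iter j t x *+ 'C(k, j)).
  by rewrite [RHS]big_ord_recr /= bin_small // mulr0n addr0.
by rewrite big_ord_recl /= !bin0.
Qed.

(** This is formally ((1+t)^n - 1)/t. For n = p prime, every coefficient except that of t^(p-1) is
    divisible by p. *)
Lemma sum_iter_one_plus n x :
  \sum_(k < n) iter k one_plus x
    = \sum_(j < n) iter j t x *+ 'C(n, j.+1).
Proof.
elim: n => [|n IHn]; first by rewrite !big_ord0.
rewrite big_ord_recr /= IHn iter_one_plus.
under [in RHS]eq_bigr do rewrite binS mulrnDr.
rewrite big_split [in RHS]big_ord_recr /= bin_small //.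
by rewrite mulr0n addr0.
Qed.

Lemma iter_affine n (f : {additive A -> A}) b x :
  iter n (fun x => f x + b) x = iter n f x + \sum_(k < n) iter k f b.
Proof.
elim: n => [|n IHn]; first by rewrite big_ord0 addr0.
rewrite iterS IHn raddfD raddf_sum big_ord_recl /=.
by rewrite -!addrA [_ + b]addrC.
Qed.

Definition in_img k u := exists a, u = iter k t a.

Lemma in_imgD k u v : in_img k u -> in_img k v -> in_img k (u + v).
Proof. by case=> a -> [b ->]; exists (a + b); rewrite raddfD. Qed.

Lemma in_imgB k u v : in_img k u -> in_img k v -> in_img k (u - v).
Proof. by case=> a -> [b ->]; exists (a - b); rewrite raddfB. Qed.

Lemma in_imgS k u : in_img k.+1 u -> in_img k u.
Proof. by case=> a ->; exists (t a); rewrite -iterSr. Qed.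

(** Modulo t, 1 + t is the identity, hence so are its powers. Each commutator with a power of the
    shear therefore gains a factor t. *)
Lemma in_img_iter_one_plus k i u : in_img k u ->
  in_img k.+1 (iter i one_plus u - u).
Proof.
move=> uk; elim: i => [|i IHi].
  by rewrite subrr; exists 0; rewrite raddf0.
rewrite iterS addrAC; apply: in_imgD => //.
have /(in_imgD uk) : in_img k (iter i one_plus u - u).
  exact: in_imgS.
by rewrite addrC subrK; case=> a ->; exists a.
Qed.

End IterAdditive.

(** * The p-group of affine permutations x -> u^i x + b, and its lower central series *)

Section Affine.
Set Implicit Arguments.
Unset Strict Implicit.
Variables (A : finZmodType) (t : {additive A -> A}) (p : nat).

Local Notation pow k := (iter k t).
Local Notation u := (one_plus t).

Implicit Types a b x y : A.

Hypotheses (p_pr : prime p) (p_odd : odd p).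
Hypothesis p2A : forall x : A, (x *+ (p ^ 2) = 0)%R.
Hypothesis tp0 : forall x : A, pow p x = 0%R.

(** For 0 < j < p, j C(p^2, j) is a multiple of p^2 and j is prime to p, so the coefficient kills A.
    For j >= p, t^j = 0. *)
Lemma iter_one_plus_p2 x : iter (p ^ 2) u x = x.
Proof.
rewrite iter_one_plus big_ord_recl /= bin0 mulr1n big1 ?addr0 // => i _.
rewrite /bump /= add1n; case: (ltnP i.+1 p) => [lt_ip | le_pi].
  have /dvdnP[m ->] : p ^ 2 %| 'C(p ^ 2, i.+1).
    rewrite -(@Gauss_dvdr _ i.+1); last first.
      by rewrite coprimeXl // prime_coprime // gtnNdvd.
    by rewrite -mul_bin_diag dvdn_mulr.
  by rewrite mulnC mulrnA p2A mul0rn.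
rewrite -iterS -(subnK le_pi) iterD tp0.
by rewrite (raddf0 (pow _)) mul0rn.
Qed.

Lemma one_plus_inj : injective u.
Proof.
have p2_gt0 : 0 < p ^ 2 by rewrite expn_gt0 prime_gt0.
move=> x y eq_xy; rewrite -(iter_one_plus_p2 x) -(iter_one_plus_p2 y).
by rewrite -(prednK p2_gt0) !iterSr /= eq_xy.
Qed.

Definition shear : {perm A} := perm one_plus_inj.
Definition trans a : {perm A} := perm (addIr a).

Lemma shearX k x : (shear ^+ k) x = iter k u x.
Proof. by rewrite permX; apply: eq_iter => y; rewrite permE. Qed.

Lemma transD a b : trans (a + b)%R = trans a * trans b.
Proof. by apply/permP => x; rewrite permM !permE addrA. Qed.

Lemma trans0 : trans 0%R = 1.
Proof. by apply/permP => x; rewrite !permE addr0. Qed.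

Lemma transX a k : trans a ^+ k = trans (a *+ k)%R.
Proof.
by elim: k => [|k IHk]; rewrite ?trans0 // expgS IHk -transD mulrS.
Qed.

Lemma trans_inj : injective trans.
Proof. by move=> a b /permP/(_ 0%R); rewrite !permE !add0r. Qed.

Definition trans_img k := [set trans (pow k a) | a : A].

Lemma trans_imgP k g :
  reflect (exists2 a, in_img t k a & g = trans a) (g \in trans_img k).
Proof.
apply: (iffP imsetP) => [[a _ ->] | [_ [a ->] ->]].
  by exists (pow k a) => //; exists a.
by exists a.
Qed.

Lemma group_set_trans_img k : group_set (trans_img k).
Proof.
apply/group_setP; split.
  by apply/imsetP; exists 0%R => //; rewrite raddf0 trans0.
move=> _ _ /imsetP[a _ ->] /imsetP[b _ ->].
by apply/imsetP; exists (a + b)%R => //; rewrite raddfD transD.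
Qed.
Canonical trans_img_group k := Group (group_set_trans_img k).

Lemma trans_conj_shear a k :
  trans a ^ (shear ^+ k) = trans (iter k u a).
Proof.
apply: (mulgI (shear ^+ k)); rewrite -conjgC; apply/permP => x.
by rewrite !permM !shearX !permE raddfD.
Qed.

Definition affine_group : {group {perm A}} := (<[shear]> <*> trans_img 0)%G.

Lemma shear_norm : <[shear]> \subset 'N(trans_img 0).
Proof.
apply/normsP => _ /cycleP[k ->]; apply/normP; rewrite inE.
apply/subsetP=> _ /imsetP[_ /imsetP[a _ ->] ->].
by rewrite trans_conj_shear; apply/imsetP; exists (iter k u a).
Qed.

Lemma affine_groupE : affine_group = <[shear]> * trans_img 0 :> {set _}.
Proof. exact: norm_joinEl shear_norm. Qed.

Lemma affine_groupP g :
  reflect (exists i a, g = shear ^+ i * trans a) (g \in affine_group).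
Proof.
rewrite affine_groupE.
apply: (iffP mulsgP) => [[_ _ /cycleP[i ->] /imsetP[a _ ->] ->] | [i [a ->]]].
  by exists i, a.
by exists (shear ^+ i) (trans a); rewrite ?mem_cycle //; apply/imsetP; exists a.
Qed.

Lemma affine_pgroup : p.-group affine_group.
Proof.
rewrite affine_groupE pgroupM; apply/andP; split.
  apply: (@pnat_dvd _ (p ^ 2)); last by rewrite pnatX pnat_id.
  rewrite order_dvdn; apply/eqP/permP => x.
  by rewrite shearX iter_one_plus_p2 perm1.
(* A translation of prime order q exists by Cauchy; its order divides p^2, so q = p. *)
apply/pgroupP => q q_pr /(Cauchy q_pr)[_ /imsetP[a _ ->] oa].
have : q %| p ^ 2 by rewrite -oa order_dvdn transX p2A trans0.
by rewrite Euclid_dvdX // andbT dvdn_prime2.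
Qed.

Lemma commg_affine i j a b :
  [~ shear ^+ i * trans a, shear ^+ j * trans b]
    = trans ((iter j u a - a) - (iter i u b - b))%R.
Proof.
rewrite commgEl conjgE; set g := _ * trans a; set h := _ * trans b.
(* Comparing g h with h g times the translation avoids computing inverses. *)
apply: (mulgI g); apply: (mulgI h); rewrite !mulKVg; apply/permP => x.
rewrite !permM !shearX !permE !raddfD /= -!iterD addnC -!addrA.
by congr (_ + _)%R; rewrite opprK [(a + _)%R]addrCA addNKr addrCA addNKr.
Qed.

Lemma affine_lcn k : 'L_k.+2(affine_group) \subset trans_img k.+1.
Proof.
elim: k => [|k IHk]; rewrite lcnSn.
  rewrite lcn1 gen_subG; apply/subsetP.
  move=> _ /imset2P[_ _ /affine_groupP[i [a ->]] /affine_groupP[j [b ->]] ->].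
  rewrite commg_affine; apply/trans_imgP; eexists; last by [].
  by apply: in_imgB; apply: in_img_iter_one_plus; eexists.
apply: subset_trans (commSg _ IHk) _.
rewrite gen_subG; apply/subsetP.
move=> _ /imset2P[_ _ /trans_imgP[a ka ->] /affine_groupP[j [b ->]] ->].
(* A translation has shear exponent 0, so only the u^j a - a term of the commutator survives. *)
rewrite -[trans a]mul1g -(expg0 shear) commg_affine /= subrr subr0.
by apply/trans_imgP; eexists; first exact: in_img_iter_one_plus ka.
Qed.

(** * Centrality of the elements of order p in the term of index p-1 *)

Hypothesis ptp0 : forall x, (pow p.-1 x *+ p = 0)%R.
Hypothesis Ohm_img : forall x, (pow p.-2 x *+ p = 0)%R -> pow p.-1 x = 0%R.
Variable a : A.
Hypothesis not_pA : forall d, pow p.-1 a <> (d *+ p)%R.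

Let p_gt2 : 2 < p. Proof. by rewrite odd_prime_gt2. Qed.

Lemma affine_Ohm : 'Ohm_1('L_p.-1(affine_group)) \subset 'Z(affine_group).
Proof.
(* As p >= 3, the index p-1 has the form k+2 required by [affine_lcn], with k = p-3. *)
have pE : p.-1 = (p - 3).+2.
  by case: p p_gt2 => [|[|[|m]]] //= _; rewrite !subSS subn0.
have p2E : p.-2 = (p - 3).+1 by rewrite pE.
have pL : p.-group 'L_p.-1(affine_group).
  exact: pgroupS (lcn_sub _ _) affine_pgroup.
rewrite (OhmE 1 pL) gen_subG; apply/subsetP => x /LdivP[Lx].
rewrite expn1 => xp1.
rewrite pE in Lx; have /trans_imgP[_ [b ->]] := subsetP (affine_lcn _) x Lx.
move=> def_x; have {}Lx := subsetP (lcn_sub _ _) x Lx.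
move: xp1; rewrite def_x transX -trans0 -p2E => /trans_inj/Ohm_img tb0.
apply/centerP; split; first by rewrite p2E -def_x.
move=> _ /affine_groupP[j [c ->]]; apply/commgP.
set v := iter _ _ _.
(* Here t v = t^(p-1) b, so u fixes v and every commutator with [trans v] is trivial. *)
have tv : t v = 0%R by rewrite -tb0 /v p2E pE.
have uv : iter j u v = v by elim: j => //= j ->; rewrite /one_plus tv addr0.
rewrite -[trans v]mul1g -(expg0 shear) commg_affine uv /= !subrr.
by rewrite trans0.
Qed.

(** * Congruences modulo pA and the failure of power closure *)

Definition in_pA x := exists d : A, x = (d *+ p)%R.

Lemma in_pAD x y : in_pA x -> in_pA y -> in_pA (x + y)%R.
Proof. by case=> c -> [d ->]; exists (c + d)%R; rewrite mulrnDl. Qed.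

Lemma in_pA_sum n (F : nat -> A) (P : pred 'I_n) :
  (forall i : 'I_n, P i -> in_pA (F i)) -> in_pA (\sum_(i < n | P i) F i)%R.
Proof.
move=> FP; apply: (big_ind in_pA) => //; last exact: in_pAD.
by exists 0%R; rewrite mul0rn.
Qed.

Lemma in_pAMn x n : p %| n -> in_pA (x *+ n)%R.
Proof. by case/dvdnP=> m ->; exists (x *+ m)%R; rewrite mulrnA. Qed.

Lemma iter_one_plus_p x : in_pA (iter p u x - x)%R.
Proof.
rewrite iter_one_plus big_ord_recl /= bin0 mulr1n addrAC subrr add0r.
have p_gt0 := prime_gt0 p_pr.
rewrite -(prednK p_gt0) big_ord_recr /= prednK //.
rewrite /bump /= add1n prednK // -iterS prednK // tp0 mul0rn addr0.
apply: in_pA_sum (fun i => iter (1 + i) t x *+ 'C(p, 1 + i))%R _ _ => i _.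
apply: in_pAMn; rewrite add1n prime_dvd_bin //=.
by rewrite -ltn_predRL ltn_ord.
Qed.

Lemma in_pA_iter_one_plus_p k x : in_pA (iter (k * p) u x - x)%R.
Proof.
elim: k => [|k IHk]; first by exists 0%R; rewrite subrr mul0rn.
rewrite mulSn iterD -(subrK (iter (k * p) u x) (iter p u _)) -addrA.
exact: in_pAD (iter_one_plus_p _) IHk.
Qed.

(** On t^(p-3) a, u^p - 1 acts as p t^(p-2) a: the later terms contain p t^(p-1) or t^p. If this
    vanished, [Ohm_img] would give t^(p-1) a = 0, which lies in pA. *)
Lemma shear_p_neq1 : shear ^+ p != 1.
Proof.
apply/eqP => /permP/(_ (pow (p - 3) a)); rewrite shearX perm1.
rewrite iter_one_plus big_ord_recl /= bin0 mulr1n.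
have p_gt0 : 0 < p := prime_gt0 p_pr.
rewrite (bigD1 (Ordinal p_gt0)) //= bin1 big1
  => [|[[|i] lt_ip] // _]; last first.
  rewrite /bump /= !add1n -(iterS i.+1).
  case: (ltngtP i.+2 p) lt_ip => // [lt_ip _ | -> _]; last first.
    by rewrite tp0 mul0rn.
  have -> : iter i.+2 t (pow (p - 3) a) = iter i t (pow p.-1 a).
    rewrite -!iterD; congr (iter _ t a).
    by case: p p_gt2 => [|[|[|m]]] //= _; rewrite !subSS subn0 !addSn !addnS.
  have /dvdnP[m ->] : p %| 'C(p, i.+2) by rewrite prime_dvd_bin.
  by rewrite mulnC mulrnA -(raddfMn (pow i)) ptp0 (raddf0 (pow _)) mul0rn.
rewrite addr0 => /(congr1 (fun y => y - pow (p - 3) a)%R).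
rewrite subrr addrAC subrr add0r -iterS => tp.
apply: (@not_pA 0%R); rewrite mul0rn; apply: Ohm_img; rewrite -[RHS]tp.
by case: p p_gt2 => [|[|[|m]]] //= _; rewrite !subSS subn0.
Qed.

(** The exact order is what turns s^(ip) = 1 into p | i. *)
Lemma shear_order : #[shear] = (p ^ 2)%N.
Proof.
have /(dvdn_pfactor _ _ p_pr)[m] : #[shear] %| p ^ 2.
  rewrite order_dvdn; apply/eqP/permP => x.
  by rewrite shearX iter_one_plus_p2 perm1.
move=> m2 om; have: ~~ (#[shear] %| p ^ 1).
  by rewrite order_dvdn expn1 shear_p_neq1.
rewrite om dvdn_Pexp2l ?prime_gt1 // -ltnNge => m1.
by congr (_ ^ _)%N; apply/eqP; rewrite eqn_leq m2.
Qed.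

Lemma affine_not_power_closed : ~ power_closed p affine_group.
Proof.
(* c = N(a) is the translation part of (s a)^p. *)
pose c := (\sum_(k < p) iter k u a)%R.
have affX i b n y : ((shear ^+ i * trans b) ^+ n) y
    = (iter (i * n) u y + \sum_(k < n) iter (i * k) u b)%R.
  pose f := iter i u.
  have fE k z : iter k f z = iter (i * k) u z.
    by elim: k => [|k IHk]; rewrite ?muln0 // mulnS iterD -IHk.
  have -> : ((shear ^+ i * trans b) ^+ n) y = iter n (fun x => f x + b)%R y.
    by rewrite permX; apply: eq_iter => z; rewrite permM permE shearX.
  rewrite (iter_affine n (iter i u)) fE; congr (_ + _)%R.
  by apply: eq_bigr => k _; rewrite fE.
have affine_in i b : shear ^+ i * trans b \in affine_group.
  by apply/affine_groupP; exists i, b.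
have MhoX g : g \in affine_group -> g ^+ p \in 'Mho^1(affine_group).
  move=> Gg; rewrite -[p in g ^+ p]expn1.
  exact: Mho_p_elt Gg (mem_p_elt affine_pgroup Gg).
have c_Mho : trans c \in 'Mho^1(affine_group).
  (* The translation by c is a product of an inverse p-th power and a p-th power, both in the Mho
     subgroup. *)
  have -> : trans c = shear ^- p * (shear ^+ 1 * trans a) ^+ p.
    apply: (mulgI (shear ^+ p)); rewrite mulKVg; apply/permP => x.
    rewrite permM affX permE shearX mul1n; congr (_ + _)%R.
    by apply: eq_bigr => k _; rewrite mul1n.
  rewrite groupM ?groupV ?MhoX //.
  by have := affine_in 1%N 0%R; rewrite trans0 mulg1.
move/(_ 1%N isT _ c_Mho)=> [_ /affine_groupP[i [b ->]]] /permP cE.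
have def_c y : (y + c = iter (i * p) u y + \sum_(k < p) iter (i * k) u b)%R.
  by have := cE y; rewrite expn1 affX permE.
(* Evaluation at 0 isolates the translation part; what remains says that s^(ip) = 1, hence p | i. *)
have c_b : (c = \sum_(k < p) iter (i * k) u b)%R.
  by have := def_c 0%R; rewrite raddf0 !add0r.
have : shear ^+ (i * p) == 1.
  apply/eqP/permP => y; rewrite shearX perm1.
  by have := def_c y; rewrite -c_b => /addIr.
rewrite -order_dvdn shear_order expnS expn1 dvdn_pmul2r ?prime_gt0 //.
case/dvdnP=> m def_i.
(* With i = mp, each u^(ik) b is congruent to b modulo p, so the sum of p of them is congruent to p
   b, hence to 0. *)
have pc : in_pA c.
  have -> : c = (\sum_(k < p) (iter (m * k * p) u b - b) + b *+ p)%R.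
    rewrite c_b sumrB sumr_const card_ord subrK; apply: eq_bigr => k _.
    by rewrite def_i mulnAC.
  apply: in_pAD; last by exists b.
  by apply: (@in_pA_sum p (fun k => iter (m * k * p) u b - b)%R) => k _;
    apply: in_pA_iter_one_plus_p.
have p_gt0 : 0 < p := prime_gt0 p_pr.
(* Removing the terms of N(a) with coefficient divisible by p leaves t^(p-1) a, contradicting
   [not_pA]. *)
have {pc}: in_pA (c - \sum_(j < p.-1) iter j t a *+ 'C(p, j.+1))%R.
  have pN : in_pA (\sum_(j < p.-1) iter j t a *+ 'C(p, j.+1))%R.
    apply: (@in_pA_sum _ (fun j => iter j t a *+ 'C(p, j.+1))%R) => j _.
    by apply: in_pAMn; rewrite prime_dvd_bin //= -ltn_predRL ltn_ord.
  by case: pc pN => d -> [e ->]; exists (d - e)%R; rewrite mulrnBl.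
rewrite /c sum_iter_one_plus -(prednK p_gt0) big_ord_recr /= addrAC subrr add0r.
by rewrite prednK // binn => -[d /not_pA].
Qed.

End Affine.

(** * The concrete module A and its shift *)

Section Model.
Set Implicit Arguments.
Unset Strict Implicit.
Variable p : nat.
Local Open Scope ring_scope.

Definition model : finZmodType :=
  HB.pack_for finZmodType ({ffun 'I_p.-1 -> 'Z_(p ^ 2)} * 'F_p)%type.

Implicit Types x y : model.

(** The default 0 outside the range allows natural-number indices such as [i.-1] without bound
    proofs. *)
Definition coef x k : 'Z_(p ^ 2) :=
  if insub k is Some i then x.1 i else 0.

Definition modp (z : 'Z_(p ^ 2)) : 'F_p := (z : nat)%:R.

Definition shift x : model :=
  ([ffun i : 'I_p.-1 => if i == 0%N :> nat then 0 else coef x i.-1],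
   modp (coef x p.-2)).

Hypotheses (p_pr : prime p) (p_odd : odd p).

Let p_gt2 : (2 < p)%N. Proof. by rewrite odd_prime_gt2. Qed.
Let p2_gt1 : (1 < p ^ 2)%N. Proof. by rewrite (ltn_exp2l 0) ?prime_gt1. Qed.
Let lt_p2_p1 : (p.-2 < p.-1)%N. Proof. by case: p p_gt2 => [|[]]. Qed.

Lemma coefB k : {morph coef^~ k : x y / x - y}.
Proof.
by move=> x y; rewrite /coef; case: insubP => [i _ _|_]; rewrite ?ffunE ?subr0.
Qed.

Lemma modp_nat n : modp n%:R = n%:R.
Proof.
rewrite /modp val_Zp_nat //; apply/val_inj; rewrite /= !val_Fp_nat //.
by rewrite modn_dvdm // dvdn_exp.
Qed.

Lemma modpD : {morph modp : y z / y + z}.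
Proof.
by move=> y z; rewrite -[y]natr_Zp -[z]natr_Zp -natrD !modp_nat natrD.
Qed.

Lemma modpB : {morph modp : y z / y - z}.
Proof. by move=> y z; apply: (addIr (modp z)); rewrite -modpD !subrK. Qed.

(** If p^2 divides zp, then p divides the representative of z. *)
Lemma modp_eq0 (z : 'Z_(p ^ 2)) : z *+ p = 0 -> modp z = 0.
Proof.
have dvd_p n : (p ^ 2 %| n * p -> p %| n)%N.
  by rewrite expnS expn1 dvdn_pmul2r ?prime_gt0.
rewrite -{1}[z]natr_Zp -mulrnA => /(congr1 val)/=; rewrite val_Zp_nat //.
move/eqP/dvd_p/dvdnP=> [m def_z].
by rewrite /modp def_z natrM pchar_Fp_0 ?mulr0.
Qed.

Lemma shift_is_zmod_morphism : zmod_morphism shift.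
Proof.
move=> x y; rewrite /shift coefB modpB; congr (_, _); apply/ffunP => i.
by rewrite !ffunE; case: eqP; rewrite ?subr0 ?coefB.
Qed.

HB.instance Definition _ :=
  GRing.isZmodMorphism.Build model model shift shift_is_zmod_morphism.

Definition shift_additive : {additive model -> model} := shift.

Lemma coef_iter_shift k x j : (j < p.-1)%N ->
  coef (iter k shift x) j = if (k <= j)%N then coef x (j - k) else 0.
Proof.
elim: k j => [|k IHk] j lt_jp; first by rewrite subn0.
rewrite iterS {1}/coef insubT /= ffunE /=; case: j lt_jp => [|j] lt_jp //=.
by rewrite IHk ?subSS // ltnW.
Qed.

Lemma iter_shift_high k x : (p.-1 <= k)%N -> (iter k shift x).1 = 0.
Proof.
move=> le_pk; apply/ffunP => i; rewrite ffunE.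
have := coef_iter_shift k x (ltn_ord i); rewrite /coef valK => ->.
by rewrite leqNgt (leq_trans (ltn_ord i)).
Qed.

Lemma coef_iter_shift_last x : coef (iter p.-2 shift x) p.-2 = coef x 0.
Proof. by rewrite coef_iter_shift // leqnn subnn. Qed.

Lemma iter_pred_shift x : iter p.-1 shift x = (0, modp (coef x 0)).
Proof.
rewrite [LHS]surjective_pairing iter_shift_high //; congr (_, _).
(* The successor form of the exponent exposes the last shift, the one that reduces modulo p. *)
suff snd_iter k : k = p.-2.+1 -> (iter k shift x).2 = modp (coef x 0).
  by apply: snd_iter; rewrite (ltn_predK lt_p2_p1).
by move=> ->; rewrite -coef_iter_shift_last.
Qed.

Lemma modelMn x n : x *+ n = (x.1 *+ n, x.2 *+ n).
Proof.
elim: n => [|n IHn]; first by rewrite !mulr0n.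
by rewrite !mulrS IHn.
Qed.

Lemma model_mulrn_p2 x : x *+ (p ^ 2) = 0.
Proof.
rewrite modelMn; congr (_, _); last first.
  by rewrite -mulr_natr natrX pchar_Fp_0 ?expr0n ?mulr0.
by apply/ffunP => i; rewrite ffunMnE -mulr_natr pchar_Zp // mulr0 ffunE.
Qed.

Lemma iter_p_shift x : iter p shift x = 0.
Proof.
rewrite -(prednK (prime_gt0 p_pr)) iterS iter_pred_shift.
rewrite [LHS]surjective_pairing; congr (_, _).
  apply/ffunP => i; rewrite /= !ffunE; case: eqP => // _.
  by rewrite /coef; case: insubP => // j _ _; rewrite ffunE.
by rewrite /= /coef; case: insubP => [j _ _|_]; rewrite ?ffunE (modp_nat 0).
Qed.

Lemma iter_pred_shiftMn x : iter p.-1 shift x *+ p = 0.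
Proof.
by rewrite iter_pred_shift modelMn mul0rn -mulr_natr pchar_Fp_0 ?mulr0.
Qed.

(** After p-2 shifts the first coordinate of x sits in the last Z/p^2 slot. If p kills it, it is
    divisible by p, so the next shift reduces it to 0. *)
Lemma iter_shift_Ohm x : iter p.-2 shift x *+ p = 0 -> iter p.-1 shift x = 0.
Proof.
rewrite iter_pred_shift -coef_iter_shift_last modelMn => -[].
set y := iter _ _ _ => /ffunP y1 _; congr (_, _).
rewrite /coef; case: insubP => [i _ _|_]; last exact: (modp_nat 0).
by apply: modp_eq0; have := y1 i; rewrite ffunMnE ffunE.
Qed.

(** Its image under t^(p-1) is (0, 1), while elements of pA have last component 0. *)
Definition unit_model : model := ([ffun i : 'I_p.-1 => (i == 0 :> nat)%:R], 0).

Lemma unit_model_not_pA (d : model) : iter p.-1 shift unit_model <> d *+ p.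
Proof.
rewrite iter_pred_shift modelMn => -[_].
rewrite -mulr_natr pchar_Fp_0 // mulr0.
have p1_gt0 : (0 < p.-1)%N := leq_ltn_trans (leq0n _) lt_p2_p1.
rewrite /coef insubT ffunE /= (modp_nat 1) => /eqP.
by rewrite oner_eq0.
Qed.

End Model.

Theorem corollary3p2 (p : nat) (p_pr : prime p) (p_odd : odd p) :
  exists (gT : finGroupType) (G : {group gT}),
    [/\ p.-group G,
        'Ohm_1('L_(p.-1)(G)) \subset 'Z(G)
      & ~ power_closed p G].
Proof.
have p2A := @model_mulrn_p2 p p_pr.
have tp0 := @iter_p_shift p p_pr p_odd.
have t_Ohm := @iter_shift_Ohm p p_pr p_odd.
pose G := @affine_group _ (shift_additive p_pr) p p_pr p2A tp0.
exists _, G; split.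
- exact: affine_pgroup.
- exact: affine_Ohm p_pr p_odd p2A tp0 t_Ohm.
- have ptp0 := @iter_pred_shiftMn p p_pr p_odd.
  have not_pA := @unit_model_not_pA p p_pr p_odd.
  exact: (@affine_not_power_closed _ (shift_additive p_pr) p p_pr p_odd
            p2A tp0 ptp0 t_Ohm _ not_pA).
Qed.
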